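(* Let $S\subseteq\mathbb{N}=\{0,1,2,\dots\}$ and let $\widehat{S}=\mathbb{Z}\setminus S$. Let $\mathscr{C}^{\widehat{S}}(z)=\sum_{\kappa}q^{k_1+\cdots+k_\ell}z^{\ell}$, the sum being over all compositions $\kappa=(k_1,\dots,k_\ell)$, $\ell\ge0$, such that $k_{i+1}-k_i\in\widehat{S}$ for all $1\le i<\ell$. Then $$\mathscr{C}^{\widehat{S}}(z)=\left(1+\sum_{k=1}^{\infty}(-1)^k\frac{q^{\binom{k+1}{2}}}{1-q^k}\,(\mathcal{S}_{k-1})!(q)\,z^k\right)^{-1},$$ where $\mathcal{S}_k(q)=\sum_{s\in S}q^{k(s-1)}$ and $(\mathcal{S}_k)!(q)=\mathcal{S}_k(q)\mathcal{S}_{k-1}(q)\cdots\mathcal{S}_1(q)$.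
   Context: A composition is a finite sequence of positive integers; the empty composition and all one-term compositions are included in the sum defining $\mathscr{C}^{\widehat{S}}(z)$. The empty product convention $(\mathcal{S}_0)!(q)=1$ is used. If $0\in S$, $\mathcal{S}_k(q)$ is a formal Laurent series in $q$; the identity is one of power series in $z$ with coefficients formal Laurent series in $q$. *)

(* Defs.v *)
From HB Require Import structures.
From mathcomp Require Import all_boot all_order all_algebra.
From mathcomp Require Import boolp classical_sets functions cardinality fsbigop.

Set Implicit Arguments.
Unset Strict Implicit.
Unset Printing Implicit Defensive.

Import Order.TTheory GRing.Theory Num.Theory.

Local Open Scope classical_set_scope.
Local Open Scope ring_scope.

(* Multiplicative inverses of an arbitrary commutative ring, by choice; *)
(* as usual in MathComp, non-units are sent to themselves.              *)
Section ClassicalInverse.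
Variable R : comNzRingType.

Definition cunit : {pred R} := fun x => `[< exists y : R, y * x = 1 >].

Definition cinv (x : R) : R :=
  if pselect (exists y : R, y * x = 1) is left h then projT1 (cid h) else x.

Lemma cmulVx : {in cunit, left_inverse 1 cinv *%R}.
Proof.
move=> x /asboolP hx; rewrite /cinv; case: pselect => // h.
by case: (cid h).
Qed.

Lemma cunitPl (x y : R) : y * x = 1 -> cunit x.
Proof. by move=> h; apply/asboolP; exists y. Qed.

Lemma cinv_out : {in [predC cunit], cinv =1 id}.
Proof.
move=> x; rewrite inE => /asboolPn hx.
by rewrite /cinv; case: pselect.
Qed.

End ClassicalInverse.

(* {fps R}: formal power series in one variable z, with the Cauchy product. *)
Record fps (R : Type) := Fps { fcoef : nat -> R }.

Notation "{ 'fps' R }" := (fps R) (at level 0, format "{ 'fps'  R }").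

HB.instance Definition _ (R : Type) := gen_eqMixin {fps R}.
HB.instance Definition _ (R : Type) := gen_choiceMixin {fps R}.

Lemma fpsP (R : Type) (f g : {fps R}) : fcoef f =1 fcoef g -> f = g.
Proof. by case: f g => [f] [g] /= /funext ->. Qed.

Section FpsRing.
Variable R : comNzRingType.
Implicit Types f g h : {fps R}.

Definition fps_zero : {fps R} := Fps (fun=> 0).
Definition fps_opp f : {fps R} := Fps (fun n => - fcoef f n).
Definition fps_add f g : {fps R} := Fps (fun n => fcoef f n + fcoef g n).
Definition fps_one : {fps R} := Fps (fun n => (n == 0)%:R).
Definition fps_mul f g : {fps R} :=
  Fps (fun n => \sum_(i < n.+1) fcoef f i * fcoef g (n - i)%N).

Lemma fps_addA : associative fps_add.
Proof. by move=> f g h; apply: fpsP => n /=; rewrite addrA. Qed.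

Lemma fps_addC : commutative fps_add.
Proof. by move=> f g; apply: fpsP => n /=; rewrite addrC. Qed.

Lemma fps_add0 : left_id fps_zero fps_add.
Proof. by move=> f; apply: fpsP => n /=; rewrite add0r. Qed.

Lemma fps_addN : left_inverse fps_zero fps_opp fps_add.
Proof. by move=> f; apply: fpsP => n /=; rewrite addNr. Qed.

HB.instance Definition _ :=
  GRing.isZmodule.Build {fps R} fps_addA fps_addC fps_add0 fps_addN.

Let trunc n f : {poly R} := \poly_(i < n.+1) fcoef f i.

Let truncE n f i : (i <= n)%N -> (trunc n f)`_i = fcoef f i.
Proof. by move=> h; rewrite coef_poly ltnS h. Qed.

Let truncM n f g i : (i <= n)%N ->
  (trunc n f * trunc n g)`_i = fcoef (fps_mul f g) i.
Proof.
move=> le_in; rewrite coefM /=; apply: eq_bigr => j _.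
rewrite !truncE // (leq_trans _ le_in) ?leq_subr //.
by rewrite -ltnS.
Qed.

Lemma fps_mulA : associative fps_mul.
Proof.
move=> f g h; apply: fpsP => n.
have -> : fcoef (fps_mul f (fps_mul g h)) n =
          (trunc n f * (trunc n g * trunc n h))`_n.
  rewrite coefM /=; apply: eq_bigr => j _.
  by rewrite truncM ?leq_subr // truncE // -ltnS.
rewrite mulrA coefM /=; apply: eq_bigr => j _.
have jn : (j <= n)%N by rewrite -ltnS.
by rewrite truncM // truncE ?leq_subr.
Qed.

Lemma fps_mulC : commutative fps_mul.
Proof.
by move=> f g; apply: fpsP => n; rewrite -!(@truncM n) // mulrC.
Qed.

Lemma fps_mul1 : left_id fps_one fps_mul.
Proof.
move=> f; apply: fpsP => n /=.
by rewrite big_ord_recl /= mul1r subn0 big1 ?addr0 // => i _; rewrite mul0r.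
Qed.

Lemma fps_mulDl : left_distributive fps_mul fps_add.
Proof.
move=> f g h; apply: fpsP => n /=; rewrite -big_split /=.
by apply: eq_bigr => i _; rewrite mulrDl.
Qed.

Lemma fps_one_neq0 : fps_one != fps_zero.
Proof.
apply/eqP => /(congr1 (fun f => fcoef f 0%N)) /= /eqP.
by rewrite oner_eq0.
Qed.

HB.instance Definition _ := GRing.Zmodule_isComNzRing.Build {fps R}
  fps_mulA fps_mulC fps_mul1 fps_mulDl fps_one_neq0.

HB.instance Definition _ := GRing.ComNzRing_hasMulInverse.Build {fps R}
  (@cmulVx {fps R}) (@cunitPl {fps R}) (@cinv_out {fps R}).

Definition fpsC (c : R) : {fps R} := Fps (fun n => if n is 0%N then c else 0).
Definition fpsX : {fps R} := Fps (fun n => (n == 1%N)%:R).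

Lemma fcoefD f g n : fcoef (f + g) n = fcoef f n + fcoef g n.
Proof. by []. Qed.

Lemma fcoefM f g n :
  fcoef (f * g) n = \sum_(i < n.+1) fcoef f i * fcoef g (n - i)%N.
Proof. by []. Qed.

Lemma fcoef1 n : fcoef (1 : {fps R}) n = (n == 0)%:R.
Proof. by []. Qed.

Lemma fcoefXM f n :
  fcoef (fpsX * f) n = if n is m.+1 then fcoef f m else 0.
Proof.
rewrite fcoefM; case: n => [|n]; first by rewrite big_ord1 /= mul0r.
rewrite big_ord_recl /= mul0r add0r big_ord_recl /= mul1r subSS subn0.
by rewrite big1 ?addr0 // => i _; rewrite mul0r.
Qed.

Lemma fcoefXn m n : fcoef (fpsX ^+ m) n = (n == m)%:R.
Proof.
by elim: m n => [|m IH] [|n]; rewrite ?expr0 // exprS fcoefXM //.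
Qed.

Lemma fcoefCM c f n : fcoef (fpsC c * f) n = c * fcoef f n.
Proof.
rewrite fcoefM big_ord_recl /= subn0 big1 ?addr0 // => i _.
by rewrite mul0r.
Qed.

End FpsRing.

Arguments fpsX {R}.

(* {laurent R}: formal Laurent series in one variable q, i.e. families of *)
(* coefficients indexed by int that vanish below some exponent.           *)
Record laurent (R : nmodType) := Laurent {
  lcoef : int -> R;
  lcoef_bounded : exists N : int, forall n : int, n < N -> lcoef n = 0 }.

Notation "{ 'laurent' R }" := (laurent R)
  (at level 0, format "{ 'laurent'  R }").

HB.instance Definition _ (R : nmodType) := gen_eqMixin {laurent R}.
HB.instance Definition _ (R : nmodType) := gen_choiceMixin {laurent R}.

Lemma laurentP (R : nmodType) (f g : {laurent R}) :
  lcoef f =1 lcoef g -> f = g.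
Proof.
case: f g => [f hf] [g hg] /= /funext fg.
by rewrite -fg in hg *; congr Laurent; exact: Prop_irrelevance.
Qed.

Section LaurentRing.
Variable R : comNzRingType.
Implicit Types (f g h : {laurent R}) (a b n : int).

Let lbnd (f : int -> R) a := forall n, n < a -> f n = 0.

Let lbnd_le (f : int -> R) a b : b <= a -> lbnd f a -> lbnd f b.
Proof. by move=> ba fa n nb; apply: fa; apply: lt_le_trans ba. Qed.

Let lbnd2 f g : exists a, lbnd (lcoef f) a /\ lbnd (lcoef g) a.
Proof.
have [a fa] := lcoef_bounded f; have [b gb] := lcoef_bounded g.
exists (Num.min a b); split.
  by apply: lbnd_le fa; rewrite ge_min lexx.
by apply: lbnd_le gb; rewrite ge_min lexx orbT.
Qed.

Lemma laurent_zero_bounded :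
  exists N : int, forall n, n < N -> (fun=> 0 : R) n = 0.
Proof. by exists 0. Qed.
Definition laurent_zero : {laurent R} := Laurent laurent_zero_bounded.

Lemma laurent_opp_bounded f :
  exists N : int, forall n, n < N -> - lcoef f n = 0.
Proof.
by have [N fN] := lcoef_bounded f; exists N => n /fN ->; rewrite oppr0.
Qed.
Definition laurent_opp f : {laurent R} := Laurent (laurent_opp_bounded f).

Lemma laurent_add_bounded f g :
  exists N : int, forall n, n < N -> lcoef f n + lcoef g n = 0.
Proof.
by have [N [fN gN]] := lbnd2 f g; exists N => n nN; rewrite fN ?gN ?addr0.
Qed.
Definition laurent_add f g : {laurent R} := Laurent (laurent_add_bounded f g).

(* Coefficient of q^n in the monomial q^m. *)
Lemma laurent_mono_bounded m :
  exists N : int, forall n, n < N -> (n == m)%:R = 0 :> R.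
Proof. by exists m => n /lt_eqF ->. Qed.
Definition laurent_mono m : {laurent R} := Laurent (laurent_mono_bounded m).

(* The sum below has finite support, because both factors are bounded below. *)
Let lmul f g n : R := \sum_(i \in [set: int]) (lcoef f i * lcoef g (n - i)).

Let lmul_bnd f g a b : lbnd (lcoef f) a -> lbnd (lcoef g) b ->
  lbnd (lmul f g) (a + b).
Proof.
move=> fa gb n nab; apply: fsbig1 => i _.
have [/fa ->|ai] := ltP i a; first by rewrite mul0r.
rewrite gb ?mulr0 // ltrBlDr; apply: lt_le_trans nab _.
by rewrite addrC lerD2l.
Qed.

Lemma laurent_mul_bounded f g :
  exists N : int, forall n, n < N ->
    \sum_(i \in [set: int]) (lcoef f i * lcoef g (n - i)) = 0.
Proof.
have [a [fa ga]] := lbnd2 f g; exists (a + a) => n.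
exact: (lmul_bnd fa ga).
Qed.
Definition laurent_mul f g : {laurent R} := Laurent (laurent_mul_bounded f g).

Let lbndM f g a b : lbnd (lcoef f) a -> lbnd (lcoef g) b ->
  lbnd (lcoef (laurent_mul f g)) (a + b).
Proof. exact: lmul_bnd. Qed.

Let shift (f : int -> R) a : {fps R} := Fps (fun m : nat => f (a + m%:Z)).

Let shift_inj f g a : lbnd (lcoef f) a -> lbnd (lcoef g) a ->
  shift (lcoef f) a = shift (lcoef g) a -> f = g.
Proof.
move=> fa ga fg; apply: laurentP => n.
have [na|an] := ltP n a; first by rewrite fa ?ga.
have -> : n = a + `|n - a|%N%:Z by rewrite gez0_abs ?subr_ge0 // addrCA subrr addr0.
exact: (congr1 (fun F => fcoef F `|n - a|%N) fg).
Qed.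

Let shiftM f g a b : lbnd (lcoef f) a -> lbnd (lcoef g) b ->
  shift (lcoef (laurent_mul f g)) (a + b) =
  shift (lcoef f) a * shift (lcoef g) b.
Proof.
move=> fa gb; apply: fpsP => m; rewrite fcoefM /=.
pose F (i : int) := lcoef f i * lcoef g (a + b + m%:Z - i).
pose r := [seq a + i%:Z | i <- iota 0 m.+1].
have ur : uniq r by rewrite map_inj_uniq ?iota_uniq // => i j /addrI [].
have -> : \sum_(i \in [set: int]) F i = \sum_(i <- r) F i.
  rewrite (fsbigE r) //; first by apply: eq_bigl => i; rewrite in_setT.
  move=> i _; apply: contraNeq => Fi0.
  have ai : a <= i.
    by rewrite leNgt; apply: contra_neqN Fi0 => /fa; rewrite /F => ->; rewrite mul0r.
  have ib : i <= a + m%:Z.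
    rewrite leNgt; apply: contra_neqN Fi0 => ami; rewrite /F gb ?mulr0 //.
    by rewrite ltrBlDr addrAC addrC ltrD2l.
  have ia : i = a + `|i - a|%N%:Z by rewrite gez0_abs ?subr_ge0 // addrCA subrr addr0.
  rewrite ia; apply: (map_f (fun j : nat => a + j%:Z)); rewrite mem_iota /= add0n ltnS.
  by rewrite -lez_nat gez0_abs ?subr_ge0 // lerBlDl.
rewrite big_map -[iota 0 m.+1]/(index_iota 0 m.+1) big_mkord.
apply: eq_bigr => i _; rewrite /F; congr (_ * lcoef g _).
have im : (i <= m)%N by rewrite -ltnS.
by rewrite -subzn // opprD addrACA [a + b]addrC addrK.
Qed.

Let laurent_one := laurent_mono 0.

Lemma laurent_addA : associative laurent_add.
Proof. by move=> f g h; apply: laurentP => n /=; rewrite addrA. Qed.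

Lemma laurent_addC : commutative laurent_add.
Proof. by move=> f g; apply: laurentP => n /=; rewrite addrC. Qed.

Lemma laurent_add0 : left_id laurent_zero laurent_add.
Proof. by move=> f; apply: laurentP => n /=; rewrite add0r. Qed.

Lemma laurent_addN : left_inverse laurent_zero laurent_opp laurent_add.
Proof. by move=> f; apply: laurentP => n /=; rewrite addNr. Qed.

HB.instance Definition _ := GRing.isZmodule.Build {laurent R}
  laurent_addA laurent_addC laurent_add0 laurent_addN.

Lemma laurent_mulA : associative laurent_mul.
Proof.
move=> f g h; have [a fa] := lcoef_bounded f.
have [b gb] := lcoef_bounded g; have [c hc] := lcoef_bounded h.
apply: (@shift_inj _ _ (a + b + c)).
- by rewrite -addrA; exact: (lbndM fa (lbndM gb hc)).
- exact: (lbndM (lbndM fa gb) hc).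
rewrite (shiftM (lbndM fa gb) hc) -addrA (shiftM fa (lbndM gb hc)).
by rewrite !shiftM // mulrA.
Qed.

Lemma laurent_mulC : commutative laurent_mul.
Proof.
move=> f g; have [a [fa ga]] := lbnd2 f g.
apply: (@shift_inj _ _ (a + a)); try exact: lbndM.
by rewrite !shiftM // mulrC.
Qed.

Lemma laurent_mul1 : left_id laurent_one laurent_mul.
Proof.
have o0 : lbnd (lcoef laurent_one) 0 by move=> n /lt_eqF /= ->.
move=> f; have [a fa] := lcoef_bounded f.
apply: (@shift_inj _ _ (0 + a)); first exact: lbndM.
  by rewrite add0r.
by rewrite (shiftM o0 fa) add0r -[RHS]mul1r; congr (_ * _).
Qed.

Lemma laurent_mulDl : left_distributive laurent_mul laurent_add.
Proof.
move=> f g h; have [a [fa ga]] := lbnd2 f g; have [b hb] := lcoef_bounded h.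
have fga : lbnd (lcoef (laurent_add f g)) a.
  by move=> n na /=; rewrite fa ?ga ?addr0.
apply: (@shift_inj _ _ (a + b)); first exact: lbndM.
  move=> n nab.
  exact: etrans (congr2 +%R (lbndM fa hb nab) (lbndM ga hb nab)) (addr0 _).
rewrite shiftM //.
transitivity (shift (lcoef (laurent_mul f h)) (a + b) +
              shift (lcoef (laurent_mul g h)) (a + b)); last exact: fpsP.
by rewrite !shiftM // -mulrDl; congr (_ * _); exact: fpsP.
Qed.

Lemma laurent_one_neq0 : laurent_one != laurent_zero.
Proof.
apply/eqP => /(congr1 (fun f => lcoef f 0)) /= /eqP.
by rewrite oner_eq0.
Qed.

HB.instance Definition _ := GRing.Zmodule_isComNzRing.Build {laurent R}
  laurent_mulA laurent_mulC laurent_mul1 laurent_mulDl laurent_one_neq0.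

HB.instance Definition _ := GRing.ComNzRing_hasMulInverse.Build {laurent R}
  (@cmulVx {laurent R}) (@cunitPl {laurent R}) (@cinv_out {laurent R}).

Definition laurentX : {laurent R} := laurent_mono 1.

Lemma lcoefD f g n : lcoef (f + g) n = lcoef f n + lcoef g n.
Proof. by []. Qed.

Lemma lcoefM f g n :
  lcoef (f * g) n = \sum_(i \in [set: int]) (lcoef f i * lcoef g (n - i)).
Proof. by []. Qed.

Lemma lcoef1 n : lcoef (1 : {laurent R}) n = (n == 0)%:R.
Proof. by []. Qed.

Lemma laurent_monoD m n :
  laurent_mono (m + n) = laurent_mono m * laurent_mono n.
Proof.
have bd k : lbnd (lcoef (laurent_mono k)) k by move=> i /lt_eqF /= ->.
have s1 k : shift (lcoef (laurent_mono k)) k = 1.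
  by apply: fpsP => i /=; rewrite -subr_eq0 addrAC subrr add0r.
apply: (@shift_inj _ _ (m + n)); [exact: bd | exact: lbndM |].
by rewrite shiftM // !s1 mulr1.
Qed.

Lemma lcoef_monoM m f n : lcoef (laurent_mono m * f) n = lcoef f (n - m).
Proof.
rewrite lcoefM (fsbigE [:: m]) //.
  by rewrite big_cons big_nil in_setT /= addr0 eqxx mul1r.
by move=> i _; rewrite inE => /negPf /= ->; rewrite mul0r.
Qed.

Lemma laurentX_unit : laurentX \is a GRing.unit.
Proof.
by apply/unitrPr; exists (laurent_mono (- 1)); rewrite -laurent_monoD subrr.
Qed.

Lemma laurentX_exp n : laurentX ^ n = laurent_mono n.
Proof.
have nat_exp (m : nat) : laurentX ^+ m = laurent_mono m.
  by elim: m => // m IH; rewrite exprS IH -laurent_monoD -PoszD add1n.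
case: n => m; first exact: nat_exp.
have u : laurent_mono m.+1 \is a GRing.unit.
  by rewrite -nat_exp unitrX // laurentX_unit.
rewrite -[LHS]/(laurentX ^- m.+1) nat_exp NegzE.
by apply: (mulrI u); rewrite divrr // -laurent_monoD subrr.
Qed.

Lemma laurentX_expn (k : nat) : laurentX ^+ k = laurent_mono k.
Proof. exact: (laurentX_exp k). Qed.

Lemma laurent_geom_unit (k : nat) :
  (0 < k)%N -> 1 - laurentX ^+ k \is a GRing.unit.
Proof.
move=> k0; pose c n : R := ((0 <= n) && (k %| `|n|)%N)%:R.
have cb : exists N : int, forall n, n < N -> c n = 0.
  by exists 0 => n n0; rewrite /c leNgt n0.
apply/unitrPr; exists (Laurent cb); apply: laurentP => n.
rewrite mulrBl mul1r laurentX_expn lcoefD -mulN1r.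
rewrite [lcoef (- 1 * _) n](_ : _ = - lcoef (Laurent cb) (n - k%:Z)); last first.
  by rewrite mulN1r -[LHS]/(- lcoef _ n) lcoef_monoM.
rewrite lcoef1 /= /c subr_ge0.
case: n => n; last by rewrite subr0.
rewrite !lez_nat leq0n /=; case: leqP => [kn|nk] /=.
  rewrite subzn // absz_nat dvdn_subl // subrr.
  by rewrite eqz_nat eqn0Ngt (leq_trans k0 kn).
rewrite subr0 eqz_nat.
by case: n nk => [|n] nk; rewrite ?dvdn0 // gtnNdvd.
Qed.

End LaurentRing.

Arguments laurentX {R}.

(* Formal sums of families: coefficients are summed separately. They are      *)
(* meaningful when the family is summable, i.e. when every coefficient        *)
(* receives finitely many nonzero contributions and, for Laurent series, the  *)
(* resulting exponents are bounded below. Otherwise they take junk values: an *)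
(* infinitely supported coefficient sum is 0, and so is a Laurent sum whose   *)
(* coefficients do not vanish below any exponent. The sums used further down  *)
(* are all summable, as the lemmas after each definition make explicit.       *)
Section FormalSums.
Variables (R : comNzRingType) (I : choiceType).

Definition laurent_sum (A : set I) (F : I -> {laurent R}) : {laurent R} :=
  if pselect (exists N : int, forall n : int, n < N ->
                \sum_(i \in A) lcoef (F i) n = 0) is left h
  then Laurent h else 0.

Definition fps_sum (A : set I) (F : I -> {fps {laurent R}}) :
    {fps {laurent R}} :=
  Fps (fun l => laurent_sum A (fun i => fcoef (F i) l)).

Lemma lcoef_sum (A : set I) (F : I -> {laurent R}) (N : int) :
  (forall i n, A i -> n < N -> lcoef (F i) n = 0) ->
  forall n, lcoef (laurent_sum A F) n = \sum_(i \in A) lcoef (F i) n.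
Proof.
move=> FN n; rewrite /laurent_sum; case: pselect => // -[]; exists N => m mN.
by apply: fsbig1 => i Ai; exact: FN.
Qed.

End FormalSums.

Section Compositions.
Variable R : comNzRingType.

Local Notation q := (laurentX : {laurent R}).
Local Notation z := (fpsX : {fps {laurent R}}).

(* Compositions whose successive differences, taken in int, all lie in D. *)
Definition compositions (D : set int) : set (seq nat) :=
  [set kappa | all (fun k => 0 < k)%N kappa /\
     forall i, (i.+1 < size kappa)%N ->
       D ((nth 0%N kappa i.+1)%:Z - (nth 0%N kappa i)%:Z)].

Definition comp_gf (D : set int) : {fps {laurent R}} :=
  fps_sum (compositions D)
    (fun kappa => fpsC (q ^+ sumn kappa) * z ^+ size kappa).

Lemma finite_compositions (D : set int) (l n : nat) :
  finite_set (compositions D `&` [set kappa | size kappa = l /\ sumn kappa = n]).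
Proof.
have fin : finite_set [set` [seq map val (val t) | t : l.-tuple 'I_n.+1]].
  exact: finite_seq.
apply: sub_finite_set fin => kappa /= [_ [sl sn]].
have le_n k : k \in kappa -> (k < n.+1)%N.
  rewrite ltnS -sn => {sl sn}; elim: kappa => //= a r IH.
  rewrite inE => /orP[/eqP->|/IH]; first exact: leq_addr.
  by move/leq_trans; apply; exact: leq_addl.
have st : size (map (@inord n) kappa) == l by rewrite size_map sl.
apply/mapP; exists (Tuple st); rewrite ?mem_enum //=.
rewrite -map_comp -[LHS]map_id; apply/eq_in_map => k kk /=.
by rewrite inordK ?le_n.
Qed.

Lemma lcoef_comp_gf (D : set int) (l : nat) (n : int) :
  lcoef (fcoef (comp_gf D) l) n =
  \sum_(kappa \in compositions D)
     (((size kappa == l) && (sumn kappa == n :> int))%:R : R).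
Proof.
have cE kappa m : lcoef (fcoef (fpsC (q ^+ sumn kappa) * z ^+ size kappa) l) m =
    ((size kappa == l) && (sumn kappa == m :> int))%:R :> R.
  rewrite fcoefCM fcoefXn laurentX_expn eq_sym.
  by case: eqP => _; rewrite ?mulr1 ?mulr0 //= eq_sym.
rewrite (@lcoef_sum _ _ _ _ 0).
  by apply: eq_fsbigr => kappa _; exact: cE.
move=> kappa m _ m0; rewrite cE; case: eqP => //= _.
by case: eqP m0 => // <-.
Qed.

(* The exponent is an integer: it is - k when s = 0. *)
Definition calS (S : set nat) (k : nat) : {laurent R} :=
  laurent_sum S (fun s => q ^ (k%:Z * (s%:Z - 1))).

Lemma lcoef_calS (S : set nat) (k : nat) (n : int) : (0 < k)%N ->
  lcoef (calS S k) n = `[< exists2 s, S s & n = k%:Z * (s%:Z - 1) >]%:R.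
Proof.
move=> k0; rewrite (@lcoef_sum _ _ _ _ (- k%:Z)); last first.
  move=> s m _ mk; rewrite laurentX_exp /=; case: eqP => // mE.
  by move: mk; rewrite mE mulrBr mulr1 gtrDr ltNge mulr_ge0.
case: asboolP => [[s Ss nE]|Sn]; last first.
  apply: fsbig1 => s Ss; rewrite laurentX_exp /=.
  by case: eqP => // nE; case: Sn; exists s.
rewrite (fsbigE [:: s]) //.
- by rewrite big_cons big_nil mem_set //= addr0 laurentX_exp /= nE eqxx.
- by move=> t /=; rewrite inE => /eqP ->.
move=> t _; rewrite inE => ts; rewrite laurentX_exp /= nE.
case: eqP => // /(mulfI _) h; case/eqP: ts.
by have /addIr [] : s%:Z - 1 = t%:Z - 1 by apply: h; rewrite eqz_nat -lt0n.
Qed.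

Definition calS_fact (S : set nat) (k : nat) : {laurent R} :=
  \prod_(1 <= j < k.+1) calS S j.

Definition denom_series (S : set nat) : {fps {laurent R}} :=
  1 + fps_sum [set k : nat | (1 <= k)%N]
    (fun k => (-1) ^+ k *
       fpsC (q ^+ 'C(k.+1, 2) / (1 - q ^+ k) * calS_fact S k.-1) * z ^+ k).

Lemma fcoef_denom_series (S : set nat) (k : nat) :
  fcoef (denom_series S) k =
  if k is 0%N then 1 else
  (-1) ^+ k * (q ^+ 'C(k.+1, 2) / (1 - q ^+ k) * calS_fact S k.-1).
Proof.
pose a k := (-1) ^+ k * (q ^+ 'C(k.+1, 2) / (1 - q ^+ k) * calS_fact S k.-1).
have sign m : (-1) ^+ m = fpsC ((-1) ^+ m) :> {fps {laurent R}}.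
  rewrite -signr_odd -[in RHS]signr_odd; case: (odd m); rewrite ?expr0 ?expr1; apply: fpsP => -[|i] //=.
  by rewrite -[LHS]/(- 0) oppr0.
have cE m : fcoef ((-1) ^+ m * fpsC (q ^+ 'C(m.+1, 2) / (1 - q ^+ m) *
    calS_fact S m.-1) * z ^+ m) k = if k == m then a m else 0.
  rewrite sign -mulrA !fcoefCM fcoefXn.
  by case: eqP => _; rewrite ?mulr1 ?mulr0.
have -> : fcoef (denom_series S) k = (k == 0)%:R + (if (0 < k)%N then a k else 0).
  rewrite fcoefD fcoef1; congr (_ + _); apply: laurentP => n.
  have [N aN] := lcoef_bounded (a k).
  rewrite (@lcoef_sum _ _ _ _ N); last first.
    by move=> m i _ iN; rewrite cE; case: eqP => // <-; exact: aN.
  have [k0|] := boolP (0 < k)%N; last first.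
    rewrite -eqn0Ngt => /eqP k0; apply: fsbig1 => m m0; rewrite cE.
    by case: eqP => // mE; move: m0; rewrite /= -mE k0.
  rewrite (fsbigE [:: k]) //.
  - by rewrite big_cons big_nil mem_set // cE eqxx /= addr0.
  - by move=> t /=; rewrite inE => /eqP ->.
  by move=> m _; rewrite inE eq_sym cE => /negPf ->.
by case: k {cE} => [|k]; rewrite ?addr0 ?add0r.
Qed.

End Compositions.

(* Main.v *)
(** For a relation on a finite weighted alphabet, let [A k] and [C k] be the
    generating functions of the words of length [k] whose successive letters
    all satisfy, respectively all violate, the relation. Cutting the product
    [A k * C m] according to whether the letters at the junction satisfy the
    relation writes it as [U k m + U k.+1 m.-1], where [U k m] counts the words
    with a satisfying prefix ending, and a violating suffix starting, at
    position [k]; hence [\sum_k (-1)^k A k C (l - k)] telescopes to [0].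

    A positive word of length [k] with first letter [a] and increments
    [s_1, ..., s_(k-1)] in [S] has sum [k a + \sum_j (k - j) s_j]; summing over
    [a] and the [s_j] independently gives the coefficient of [z^k] in the
    denominator. The alphabet is truncated to [1, ..., N], which does not affect
    the coefficients of [q^n] for [n <= N]. *)
Require Import Defs.
From HB Require Import structures.
From mathcomp Require Import all_boot all_order all_algebra.
From mathcomp Require Import boolp classical_sets functions cardinality fsbigop.
From mathcomp Require Import ring zify.

Set Implicit Arguments.
Unset Strict Implicit.
Unset Printing Implicit Defensive.

Import Order.TTheory GRing.Theory Num.Theory.

Local Open Scope classical_set_scope.
Local Open Scope ring_scope.

(** * Words over a finite alphabet *)

Fixpoint words (T : Type) (r : seq T) (l : nat) : seq (seq T) :=
  if l is l'.+1 then [seq x :: t | x <- r, t <- words r l'] else [:: [::]].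


Lemma words_uniq (T : eqType) (r : seq T) (l : nat) :
  uniq r -> uniq (words r l).
Proof.
move=> ur; elim: l => //= l IH.
by apply: allpairs_uniq => // -[x s] [y t] _ _ /= [-> ->].
Qed.

Lemma mem_words (T : eqType) (r : seq T) (l : nat) (t : seq T) :
  (t \in words r l) = (size t == l) && all [in r] t.
Proof.
elim: l t => [|l IH] [|x t] //=; first by apply/allpairsP => -[[]] ? ? [].
rewrite eqSS; apply/allpairsP/idP => [[[y s] /= [yr]]|].
  by rewrite IH => /andP[sl sr] [-> ->]; rewrite sl yr.
by case/and3P=> tl xr tr; exists (x, t); rewrite /= IH tl xr tr.
Qed.

(** * Transfer operators and the alternating inversion identity *)

Section ChainInversion.
Variables (T : Type) (L : comNzRingType) (r : seq T) (w : T -> L).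
Implicit Types (e : rel T) (f g : T -> L).

Definition chain_gf e (l : nat) : L :=
  \sum_(t <- words r l | sorted e t) \prod_(x <- t) w x.

Definition wsum f : L := \sum_(x <- r) w x * f x.

(** The transfer matrix of [e]: each step weighs the letter entered, so the weight of the first
    letter comes from [wsum]. *)
Definition transfer e f : T -> L := fun x => \sum_(y <- r | e x y) w y * f y.

Lemma iter_transfer_one e l x :
  iter l (transfer e) (fun=> 1) x =
  \sum_(t <- words r l | path e x t) \prod_(y <- t) w y.
Proof.
elim: l x => [|l IH] x /=; first by rewrite big_cons big_nil /= big_nil addr0.
rewrite big_mkcond big_allpairs_dep /= /transfer big_mkcond /=.
apply: eq_bigr => y _; case: (e x y); last by rewrite big1.
rewrite -big_mkcond IH mulr_sumr; apply: eq_bigr => t _.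
by rewrite big_cons.
Qed.

Lemma chain_gf0 e : chain_gf e 0 = 1.
Proof. by rewrite /chain_gf /= big_cons big_nil /= big_nil addr0. Qed.

Lemma chain_gfS e l : chain_gf e l.+1 = wsum (iter l (transfer e) (fun=> 1)).
Proof.
rewrite /chain_gf /= big_mkcond big_allpairs_dep /=; apply: eq_bigr => x _.
rewrite iter_transfer_one mulr_sumr [RHS]big_mkcond /=; apply: eq_bigr => t _.
by rewrite big_cons.
Qed.

Lemma iter_transferD e l f g x :
  iter l (transfer e) (fun x => f x + g x) x =
  iter l (transfer e) f x + iter l (transfer e) g x.
Proof.
elim: l x => //= l IH x; rewrite /transfer -big_split /=.
by apply: eq_bigr => y _; rewrite IH mulrDr.
Qed.

Lemma iter_transfer_cst e l c x :
  iter l (transfer e) (fun=> c) x = iter l (transfer e) (fun=> 1) x * c.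
Proof.
elim: l x => [|l IH] x /=; first by rewrite mul1r.
by rewrite /transfer mulr_suml; apply: eq_bigr => y _; rewrite IH mulrA.
Qed.

Lemma transfer_compl e f :
  (fun x => transfer e f x + transfer (fun x y => ~~ e x y) f x) =
  (fun=> wsum f).
Proof. by apply/funext => x; rewrite /wsum (bigID (e x)). Qed.

Lemma chain_gfM e k m :
  let U i j := wsum (iter i (transfer e)
                 (iter j (transfer (fun x y => ~~ e x y)) (fun=> 1))) in
  chain_gf e k.+1 * chain_gf (fun x y => ~~ e x y) m.+1 =
  U k.+1 m + U k m.+1.
Proof.
move=> U; rewrite !chain_gfS {1}/wsum mulr_suml /U iterSr {1 3}/wsum -big_split /=.
apply: eq_bigr => x _; rewrite -mulrDr -mulrA; congr (_ * _).
by rewrite -/(wsum _) -iter_transfer_cst -(transfer_compl e) iter_transferD.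
Qed.

Lemma chain_inversion e l :
  \sum_(i < l.+1) (-1) ^+ i * chain_gf e i
     * chain_gf (fun x y => ~~ e x y) (l - i)%N = (l == 0)%:R.
Proof.
case: l => [|l]; first by rewrite big_ord1 !chain_gf0 !mulr1.
pose U i j := wsum (iter i (transfer e)
                (iter j (transfer (fun x y => ~~ e x y)) (fun=> 1))).
pose V i := - (-1) ^+ i * U i (l - i)%N.
rewrite big_ord_recl big_ord_recr /= !chain_gf0 !mul1r /bump /= subn0 add1n.
rewrite subnn chain_gf0 mulr1.
(* The extreme terms, where one factor is the empty chain, are [- V 0] and [V l]; by [chain_gfM]
   each inner term is a difference of consecutive [V]. *)
transitivity (- V 0%N + \sum_(0 <= i < l) (V i - V i.+1) + V l).
  rewrite big_mkord /V expr0 !mulN1r opprK subn0 subnn -[U 0%N l]chain_gfS.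
  rewrite -[U l 0%N]chain_gfS exprS mulN1r addrA; congr (_ + _ + _).
  apply: eq_bigr => i _; rewrite add1n subSS -mulrA.
  have il := ltn_ord i.
  rewrite -[in LHS](subnSK il) chain_gfM -/(U _ _) -/(U _ _).
  by rewrite (subnSK il) exprS; ring.
rewrite (telescope_sumr_eq (fun i => - V i)) //; last by move=> i _; ring.
by ring.
Qed.

End ChainInversion.

(** * The q-adic filtration on Laurent series *)

Section LaurentOrder.
Variable R : comNzRingType.
Implicit Types (f g : {laurent R}) (M N : int).
Local Notation q := (laurentX : {laurent R}).

Definition ord_ge N f := forall n, n < N -> lcoef f n = 0.

Lemma ord_ge_le M N f : M <= N -> ord_ge N f -> ord_ge M f.
Proof. by move=> MN fN n nM; apply: fN; apply: lt_le_trans MN. Qed.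

Lemma ord_ge0 N : ord_ge N 0.
Proof. by []. Qed.

Lemma ord_geD N f g : ord_ge N f -> ord_ge N g -> ord_ge N (f + g).
Proof. by move=> fN gN n nN; rewrite lcoefD fN // gN // addr0. Qed.

Lemma ord_geN N f : ord_ge N f -> ord_ge N (- f).
Proof. by move=> fN n nN; rewrite -[LHS]/(- lcoef f n) fN // oppr0. Qed.

Lemma ord_ge_sign N (i : nat) f : ord_ge N f -> ord_ge N ((-1) ^+ i * f).
Proof.
by rewrite -signr_odd; case: odd; rewrite ?mulN1r ?mul1r //; exact: ord_geN.
Qed.

Lemma ord_ge_sum N (I : Type) (r : seq I) (P : pred I) (F : I -> {laurent R}) :
  (forall i, P i -> ord_ge N (F i)) -> ord_ge N (\sum_(i <- r | P i) F i).
Proof. by move=> FN; elim/big_ind: _ => //; exact: ord_geD. Qed.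

Lemma ord_geM M N f g : ord_ge M f -> ord_ge N g -> ord_ge (M + N) (f * g).
Proof.
move=> fM gN n nMN; rewrite lcoefM; apply: fsbig1 => i _.
have [/fM ->|Mi] := ltP i M; first by rewrite mul0r.
by rewrite gN ?mulr0 //; lia.
Qed.

Lemma ord_geMl N f g : ord_ge 0 f -> ord_ge N g -> ord_ge N (f * g).
Proof. by move=> f0 gN; rewrite -[N]add0r; exact: ord_geM. Qed.

Lemma ord_geMr N f g : ord_ge N f -> ord_ge 0 g -> ord_ge N (f * g).
Proof. by move=> fN g0; rewrite mulrC; exact: ord_geMl. Qed.

Lemma ord_geX (k : nat) : ord_ge k (q ^+ k).
Proof. by move=> n nk; rewrite laurentX_expn /= lt_eqF. Qed.

Lemma ord_geX0 (k : nat) : ord_ge 0 (q ^+ k).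
Proof. by apply: ord_ge_le (@ord_geX k). Qed.

(** The inverse [g] satisfies [g = 1 + q ^+ k * g], so its coefficients at negative exponents are
    unchanged by shifting down by [k]; boundedness below forces them to vanish. *)
Lemma ord_ge_inv_geom (k : nat) : (0 < k)%N -> ord_ge 0 (1 - q ^+ k)^-1.
Proof.
move=> k0; set g := _^-1.
have gE n : n < 0 -> lcoef g n = lcoef g (n - k%:Z).
  move=> n0; have gqg : g = 1 + q ^+ k * g.
    have := mulVr (laurent_geom_unit R k0); rewrite -/g mulrBr mulr1.
    by move/eqP; rewrite subr_eq mulrC => /eqP.
  by rewrite [in LHS]gqg lcoefD lcoef1 lt_eqF // add0r laurentX_expn lcoef_monoM.
have [N gN] := lcoef_bounded g.
have iter_gE (m : nat) n : n < 0 -> lcoef g n = lcoef g (n - (m * k)%:Z).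
  elim: m n => [|m IH] n n0; first by rewrite mul0n subr0.
  by rewrite gE // IH; [congr lcoef; lia | lia].
by move=> n n0; rewrite (iter_gE `|N|%N) // gN //; nia.
Qed.

Lemma eq_laurent f g : (forall N : nat, ord_ge N (f - g)) -> f = g.
Proof.
move=> fg; apply/eqP; rewrite -subr_eq0; apply/eqP/laurentP => n.
by apply: (fg `|n|.+1%N); lia.
Qed.

End LaurentOrder.

(** * Truncated generating functions for increments in [S] and their complement *)

Section ChainsWithSteps.
Variables (R : comNzRingType) (S : set nat).
Local Notation q := (laurentX : {laurent R}).

(** The guard [a <= b] keeps truncated subtraction from reading a decrease as the increment 0. *)
Definition step : rel nat := fun a b => (a <= b)%N && `[< S (b - a)%N >].

Lemma stepP (a b : nat) :
  reflect (exists2 s, S s & b = (a + s)%N) (step a b).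
Proof.
apply: (iffP andP) => [[ab /asboolP Sba]|[s Ss ->]].
  by exists (b - a)%N => //; rewrite subnKC.
by rewrite leq_addr addKn; split=> //; apply/asboolP.
Qed.

Definition trunc_gf (e : rel nat) (N l : nat) : {laurent R} :=
  chain_gf (index_iota 1 N.+1) (fun a => q ^+ a) e l.

Lemma trunc_gfE e N l :
  trunc_gf e N l =
  \sum_(t <- words (index_iota 1 N.+1) l | sorted e t) q ^+ sumn t.
Proof. by apply: eq_bigr => t _; rewrite prodrXr sumnE. Qed.

Lemma trunc_gf_ord e N l : ord_ge 0 (trunc_gf e N l).
Proof. by rewrite trunc_gfE; apply: ord_ge_sum => t _; exact: ord_geX0. Qed.

(* Generating function of the contribution of [k] free increments in [S] to
   the sum of a word of length [k + 1]. *)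
Definition steps_gf (k : nat) : {laurent R} :=
  q ^+ 'C(k.+1, 2) * calS_fact R S k.

Lemma steps_gf0 : steps_gf 0 = 1.
Proof. by rewrite /steps_gf /calS_fact big_geq // mulr1. Qed.

(** Pascal's rule splits [q ^+ k.+1] off the binomial power; it turns the exponents [k.+1 * (s - 1)]
    of [calS] into [k.+1 * s]. *)
Lemma steps_gfS k : steps_gf k.+1 = steps_gf k * (q ^+ k.+1 * calS R S k.+1).
Proof.
by rewrite /steps_gf /calS_fact binS bin1 exprD [in LHS]big_nat_recr //=; ring.
Qed.

Lemma lcoef_step_gf (k a : nat) (n : int) : (0 < k)%N ->
  lcoef (q ^+ (k * a) * (q ^+ k * calS R S k)) n =
  `[< exists2 s, S s & n = (k * (a + s))%:Z >]%:R.
Proof.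
move=> k0; rewrite mulrA -exprD laurentX_expn lcoef_monoM lcoef_calS //.
congr ((nat_of_bool _)%:R); apply: asbool_equiv_eq; split=> -[s Ss nE]; exists s => //; lia.
Qed.

Lemma step_gf_ord k : (0 < k)%N -> ord_ge 0 (q ^+ k * calS R S k).
Proof.
move=> k0 n n0; rewrite -[_ * _]mul1r -(expr0 q) -[0%N](muln0 k) lcoef_step_gf //.
by case: asboolP => // -[s _ nE]; lia.
Qed.

Lemma steps_gf_ord k : ord_ge 0 (steps_gf k).
Proof.
elim: k => [|k IH]; first by rewrite steps_gf0; exact: (@ord_geX0 R 0).
by rewrite steps_gfS; apply: ord_geMl => //; exact: step_gf_ord.
Qed.

(** The successors of [a] are the [a + s] with [s] in [S]; those lost by truncation exceed [N],
    hence so do their exponents [k * (a + s)]. *)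
Lemma sum_step_approx (N k a : nat) : (0 < k)%N -> (0 < a)%N ->
  ord_ge N.+1 (\sum_(1 <= b < N.+1 | step a b) q ^+ (k * b)
                 - q ^+ (k * a) * (q ^+ k * calS R S k)).
Proof.
move=> k0 a0 n nN; rewrite lcoefD -[lcoef (- _) n]/(- lcoef _ n).
apply/eqP; rewrite subr_eq0; apply/eqP; rewrite lcoef_step_gf //.
rewrite (big_morph (fun f => lcoef f n) (id1 := 0) (op1 := +%R)) //.
under eq_bigr do rewrite laurentX_expn /=.
case: asboolP => [[s Ss nE]|noS]; last first.
  rewrite big1 // => b /stepP[s Ss bE]; case: eqP => // nE; case: noS.
  by exists s => //; rewrite nE bE.
rewrite big_mkcond (bigD1_seq (a + s)%N) ?iota_uniq //=; last first.
  by rewrite mem_index_iota; nia.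
have -> : step a (a + s)%N by apply/stepP; exists s.
rewrite nE eqxx big1 ?addr0 // => b bas; case: ifP => // _.
by rewrite eqz_nat eqn_pmul2l // eq_sym (negPf bas).
Qed.

(** A first increment to [b] contributes [q ^+ b], which merges with the inductive [q ^+ (k * b)]
    into the sum of [sum_step_approx] for [k.+1]. *)
Lemma iter_transfer_step_approx (N k a : nat) : (0 < a)%N ->
  ord_ge N.+1
    (iter k (transfer (index_iota 1 N.+1) (fun b => q ^+ b) step) (fun=> 1) a
       - q ^+ (k * a) * steps_gf k).
Proof.
elim: k a => [|k IH] a a0.
  by rewrite mul0n steps_gf0 mulr1 subrr; exact: ord_ge0.
rewrite /= {1}/transfer; set f := iter _ _ _ in IH *.
rewrite (_ : _ - _ =
    \sum_(1 <= b < N.+1 | step a b) q ^+ b * (f b - q ^+ (k * b) * steps_gf k)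
    + steps_gf k * (\sum_(1 <= b < N.+1 | step a b) q ^+ (k.+1 * b)
        - q ^+ (k.+1 * a) * (q ^+ k.+1 * calS R S k.+1))).
  apply: ord_geD.
    rewrite big_seq_cond; apply: ord_ge_sum => b /andP[].
    rewrite mem_index_iota => /andP[b0 _] _.
    by apply: ord_geMl; [exact: ord_geX0 | exact: IH].
  by apply: ord_geMl; [exact: steps_gf_ord | exact: sum_step_approx].
rewrite steps_gfS mulrBr mulr_sumr addrA -big_split /=; congr (_ - _); last by ring.
by apply: eq_bigr => b _; rewrite mulSn exprD; ring.
Qed.

Lemma trunc_gf_step_approx (N k : nat) :
  ord_ge N.+1 (trunc_gf step N k.+1
    - q ^+ 'C(k.+2, 2) / (1 - q ^+ k.+1) * calS_fact R S k).
Proof.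
have u := laurent_geom_unit R (ltn0Sn k).
have geom M : \sum_(1 <= b < M.+1) q ^+ (k.+1 * b) =
    (q ^+ k.+1 - q ^+ (k.+1 * M.+1)) / (1 - q ^+ k.+1).
  apply: (mulIr u); rewrite divrK //.
  elim: M => [|M IH]; first by rewrite big_geq // muln1 subrr mul0r.
  by rewrite big_nat_recr //= mulrDl IH [in RHS]mulnSr exprD; ring.
rewrite /trunc_gf chain_gfS /wsum; set f := iter _ _ _.
(* Summing over the first letter gives a finite geometric series; its missing tail starts at
   [q ^+ (k.+1 * N.+1)], beyond the precision. *)
rewrite (_ : _ - _ =
    \sum_(1 <= b < N.+1) q ^+ b * (f b - q ^+ (k * b) * steps_gf k)
    - q ^+ (k.+1 * N.+1) * ((1 - q ^+ k.+1)^-1 * steps_gf k)).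
  apply: ord_geD.
    rewrite big_seq_cond; apply: ord_ge_sum => b /andP[].
    rewrite mem_index_iota => /andP[b0 _] _.
    by apply: ord_geMl; [exact: ord_geX0 | exact: iter_transfer_step_approx].
  apply/ord_geN/ord_geMr.
    by apply: ord_ge_le (@ord_geX R _); rewrite lez_nat leq_pmull.
  by apply: ord_geMl; [exact: ord_ge_inv_geom | exact: steps_gf_ord].
have -> : \sum_(1 <= b < N.+1) q ^+ b * (f b - q ^+ (k * b) * steps_gf k) =
    \sum_(1 <= b < N.+1) q ^+ b * f b
    - (\sum_(1 <= b < N.+1) q ^+ (k.+1 * b)) * steps_gf k.
  rewrite mulr_suml -sumrB; apply: eq_bigr => b _.
  by rewrite mulSn exprD; ring.
by rewrite geom /steps_gf binS bin1 exprD; ring.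
Qed.

Lemma compositions_avoiding (t : seq nat) :
  compositions (~` [set Posz s | s in S]) t <->
  all (leq 1) t /\ sorted (fun a b => ~~ step a b) t.
Proof.
have stepE a b : ~~ step a b <-> (~` [set Posz s | s in S]) (b%:Z - a%:Z).
  split=> [/negP nab [s Ss sE]|nab].
    by apply: nab; apply/stepP; exists s => //; lia.
  by apply/negP => /stepP[s Ss bE]; apply: nab; exists s => //; lia.
rewrite /compositions /=; split=> -[t0 tD]; split=> //.
  case: t t0 tD => //= a t _ tD; apply/(pathP 0%N) => i it; apply/stepE.
  exact: tD.
move=> i; case: t t0 tD => //= a t _ /(pathP 0%N) tD it; apply/stepE.
exact: tD.
Qed.

(** No part of a composition exceeds its sum, so compositions of [n <= N] only use letters of the
    truncated alphabet. *)
Lemma comp_gf_approx (N l : nat) :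
  ord_ge N.+1 (trunc_gf (fun a b => ~~ step a b) N l
    - fcoef (comp_gf R (~` [set Posz s | s in S])) l).
Proof.
move=> n nN; rewrite lcoefD -[lcoef (- _) n]/(- lcoef _ n) lcoef_comp_gf.
apply/eqP; rewrite subr_eq0; apply/eqP; rewrite trunc_gfE.
rewrite (big_morph (fun f => lcoef f n) (id1 := 0) (op1 := +%R)) //.
set r := words (index_iota 1 N.+1) l; set e := fun a b => ~~ step a b.
have memr t : t \in [seq t <- r | sorted e t] ->
    compositions (~` [set Posz s | s in S]) t /\ size t = l.
  rewrite mem_filter mem_words => /and3P[te /eqP tl /allP tr].
  split=> //; apply/compositions_avoiding; split=> //; apply/allP => x /tr /=.
  by rewrite mem_index_iota => /andP[].
rewrite (fsbigE [seq t <- r | sorted e t]).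
- rewrite -[LHS]big_filter [LHS]big_seq [RHS]big_seq_cond.
  apply: eq_big => t; last first.
    move=> /memr[_ tl]; rewrite laurentX_expn /= tl eqxx.
    by rewrite eq_sym.
  apply/idP/andP => [tr|[] //]; split=> //; rewrite inE.
  by have [] := memr t tr.
- by apply/filter_uniq/words_uniq; exact: iota_uniq.
- by move=> t /= /memr[].
move=> t /compositions_avoiding[/allP t0 te]; rewrite mem_filter te mem_words.
case: (size t == l) => //=; case: eqP => //= tn /negP[].
apply/allP => x xt /=; rewrite mem_index_iota t0 //=.
have : (x <= sumn t)%N by rewrite (perm_sumn (perm_to_rem xt)) leq_addr.
lia.
Qed.

End ChainsWithSteps.

(** * From the truncated identity to power series *)

Theorem corollary29 (R : comNzRingType) (S : set nat) :
  denom_series R S \is a GRing.unit /\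
  comp_gf R (~` [set Posz s | s in S]) = (denom_series R S)^-1.
Proof.
set D := denom_series R S; set C := comp_gf _ _.
suff DC : D * C = 1.
  have uD : D \is a GRing.unit by apply/unitrPr; exists C.
  by split=> //; apply: (mulrI uD); rewrite divrr.
apply: fpsP => l; apply: eq_laurent => N.
pose A := trunc_gf R (step S) N.
pose B := trunc_gf R (fun a b => ~~ step S a b) N.
have A_approx i : ord_ge N.+1 ((-1) ^+ i * A i - fcoef D i).
  rewrite fcoef_denom_series; case: i => [|i].
    by rewrite /A /trunc_gf chain_gf0 mulr1 subrr; exact: ord_ge0.
  by rewrite -mulrBr; apply/ord_ge_sign/trunc_gf_step_approx.
have B_approx i : ord_ge N.+1 (B i - fcoef C i) by exact: comp_gf_approx.
(* The coefficient of 1 is rewritten as the truncated alternating sum, leaving a termwise comparison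
   of products modulo [q ^+ N.+1]. *)
rewrite fcoef1 -(chain_inversion (index_iota 1 N.+1) (fun a => laurentX ^+ a) (step S)).
rewrite fcoefM -sumrB; apply: ord_ge_sum => i _.
set j := (l - i)%N; rewrite -[chain_gf _ _ _ i]/(A i) -[chain_gf _ _ _ j]/(B j).
have A_ord : ord_ge 0 ((-1) ^+ i * A i) by apply/ord_ge_sign/trunc_gf_ord.
have C_ord : ord_ge 0 (fcoef C j).
  (* Nonnegative order passes from the truncation [B j] to [fcoef C j] through their difference. *)
  rewrite -[fcoef C j](subKr (B j)); apply: ord_geD; first exact: trunc_gf_ord.
  by apply/ord_geN/(ord_ge_le _ (B_approx j)).
rewrite (_ : _ - _ = - (((-1) ^+ i * A i - fcoef D i) * fcoef C j
                        + (-1) ^+ i * A i * (B j - fcoef C j))); last by ring.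
apply: ord_geN; apply: (@ord_ge_le _ _ N.+1); first by lia.
by apply: ord_geD; [exact: ord_geMr | exact: ord_geMl].
Qed.
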